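(* For every integer $n \ge 3$, the twin group $T_n$ has the $R_\infty$-property; that is, for every automorphism $\phi$ of $T_n$, the number of $\phi$-twisted conjugacy classes of $T_n$ is infinite.
   Context: For $n \ge 2$, the twin group $T_n$ is the group with presentation $$T_n=\langle s_1, \dots, s_{n-1} \mid s_i^2 = 1 \ (1 \le i \le n-1),\ s_i s_j = s_j s_i \text{ for } |i-j| \ge 2 \rangle.$$ Let $G$ be a group and $\phi$ an automorphism of $G$. Two elements $x, y \in G$ are $\phi$-conjugate ($\phi$-twisted conjugate) if there exists $g \in G$ with $x = g\, y\, \phi(g)^{-1}$. This is an equivalence relation on $G$, and its classes are the $\phi$-twisted conjugacy classes; their number is denoted $R(\phi) \in \mathbb{N} \cup \{\infty\}$. The group $G$ has the $R_\infty$-property if $R(\phi) = \infty$ for every $\phi \in \mathrm{Aut}(G)$. *)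

(* Defs.v *)
From HB Require Import structures.
From mathcomp Require Import all_boot.
From mathcomp Require Import boolp classical_sets cardinality.

Set Implicit Arguments.
Unset Strict Implicit.
Unset Printing Implicit Defensive.

Local Open Scope quotient_scope.
Local Open Scope group_scope.
Local Open Scope classical_set_scope.

(* The letter (i, true) is the generator i, and (i, false) its formal inverse. *)
Definition word (I : Type) : Type := seq (I * bool).

Definition letter_inv (I : Type) (a : I * bool) : I * bool := (a.1, ~~ a.2).

Definition word_inv (I : Type) (u : word I) : word I :=
  rev [seq letter_inv a | a <- u].

(* The congruence on words generated by the free cancellations and by the     *)
(* relations "u = v" for rels u v.                                            *)
Inductive word_eq (I : Type) (rels : word I -> word I -> Prop) :
    word I -> word I -> Prop :=
  | WordRefl u : word_eq rels u u
  | WordSym u v : word_eq rels u v -> word_eq rels v u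
  | WordTrans u v w : word_eq rels u v -> word_eq rels v w -> word_eq rels u w
  | WordCat u u' v v' : word_eq rels u u' -> word_eq rels v v' ->
      word_eq rels (u ++ v) (u' ++ v')
  | WordCancel a : word_eq rels [:: a; letter_inv a] [::]
  | WordRel u v : rels u v -> word_eq rels u v.

Definition word_eqb (I : choiceType) (rels : word I -> word I -> Prop) :
    rel (seq (I * bool)) :=
  fun u v => `[< word_eq rels u v >].

Lemma word_eqb_equiv (I : choiceType) (rels : word I -> word I -> Prop) :
  equiv_class_of (word_eqb rels).
Proof.
split.
- by move=> u; apply/asboolP; exact: WordRefl.
- by move=> u v; apply/asboolP/asboolP; exact: WordSym.
- move=> v u w /asboolP uv /asboolP vw; apply/asboolP.
  exact: WordTrans uv vw.
Qed.

Canonical word_eqb_equiv_rel (I : choiceType)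
    (rels : word I -> word I -> Prop) :=
  EquivRelPack (word_eqb_equiv rels).

(* The group with presentation < I | u = v for rels u v >. *)
Definition presented (I : choiceType) (rels : word I -> word I -> Prop) : Type :=
  {eq_quot word_eqb rels}.

HB.instance Definition _ (I : choiceType) (rels : word I -> word I -> Prop) :=
  Choice.on (presented rels).
HB.instance Definition _ (I : choiceType) (rels : word I -> word I -> Prop) :=
  EqQuotient.on (presented rels).

Definition class_of_word (I : choiceType) (rels : word I -> word I -> Prop)
    (u : word I) : presented rels := \pi_(presented rels) u.

Definition presented_one (I : choiceType) (rels : word I -> word I -> Prop) :
    presented rels := class_of_word rels [::].

Definition presented_mul (I : choiceType) (rels : word I -> word I -> Prop)
    (x y : presented rels) : presented rels :=
  class_of_word rels (repr x ++ repr y).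

Definition presented_inv (I : choiceType) (rels : word I -> word I -> Prop)
    (x : presented rels) : presented rels :=
  class_of_word rels (word_inv (repr x)).

Lemma class_of_wordP (I : choiceType) (rels : word I -> word I -> Prop) u v :
  class_of_word rels u = class_of_word rels v <-> word_eq rels u v.
Proof.
split; first by move/eqmodP/asboolP.
by move=> uv; apply/eqmodP/asboolP.
Qed.

Lemma class_of_word_repr (I : choiceType) (rels : word I -> word I -> Prop)
  (x : presented rels) : class_of_word rels (repr x) = x.
Proof. exact: reprK. Qed.

Lemma presented_ind (I : choiceType) (rels : word I -> word I -> Prop)
    (P : presented rels -> Prop) :
  (forall u, P (class_of_word rels u)) -> forall x, P x.
Proof. by move=> Pu x; rewrite -(class_of_word_repr x). Qed.

Lemma word_eq_repr (I : choiceType) (rels : word I -> word I -> Prop) u :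
  word_eq rels (repr (class_of_word rels u)) u.
Proof. by apply/class_of_wordP; rewrite class_of_word_repr. Qed.

Lemma letter_invK (I : Type) : involutive (@letter_inv I).
Proof. by case=> i b; rewrite /letter_inv negbK. Qed.

Lemma word_invK (I : Type) : involutive (@word_inv I).
Proof.
by move=> u; rewrite /word_inv map_rev revK (mapK (@letter_invK I)).
Qed.

Lemma word_inv_cat (I : Type) (u v : word I) :
  word_inv (u ++ v) = word_inv v ++ word_inv u.
Proof. by rewrite /word_inv map_cat rev_cat. Qed.

Lemma word_mulV (I : Type) (rels : word I -> word I -> Prop) (u : word I) :
  word_eq rels (u ++ word_inv u) [::].
Proof.
elim: u => [|a u IHu]; first exact: WordRefl.
rewrite -cat1s word_inv_cat -catA [u ++ _]catA.
apply: WordTrans (WordCancel rels a).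
apply: WordCat (WordRefl _ _) _.
exact: (WordCat IHu (WordRefl rels _)).
Qed.

Lemma word_Vmul (I : Type) (rels : word I -> word I -> Prop) (u : word I) :
  word_eq rels (word_inv u ++ u) [::].
Proof. by have := word_mulV rels (word_inv u); rewrite word_invK. Qed.

Lemma word_eq_inv (I : Type) (rels : word I -> word I -> Prop) (u v : word I) :
  word_eq rels u v -> word_eq rels (word_inv u) (word_inv v).
Proof.
move=> uv; rewrite -[word_inv u]cats0.
apply: WordTrans (WordCat (WordRefl _ _) (WordSym (word_mulV rels v))) _.
rewrite catA -[X in word_eq _ _ X]cat0s.
apply: WordCat (WordRefl _ _).
apply: WordTrans (WordCat (WordRefl _ _) (WordSym uv)) _.
exact: word_Vmul.
Qed.

Lemma presented_mulE (I : choiceType) (rels : word I -> word I -> Prop) u v :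
  presented_mul (class_of_word rels u) (class_of_word rels v) =
  class_of_word rels (u ++ v).
Proof. by apply/class_of_wordP; apply: WordCat; exact: word_eq_repr. Qed.

Lemma presented_invE (I : choiceType) (rels : word I -> word I -> Prop) u :
  presented_inv (class_of_word rels u) = class_of_word rels (word_inv u).
Proof. by apply/class_of_wordP/word_eq_inv; exact: word_eq_repr. Qed.

Section PresentedGroup.
Context (I : choiceType) (rels : word I -> word I -> Prop).

Lemma presented_mulA : associative (@presented_mul I rels).
Proof.
elim/presented_ind=> u; elim/presented_ind=> v; elim/presented_ind=> w.
by rewrite !presented_mulE catA.
Qed.

Lemma presented_mul1 : left_id (presented_one rels) (@presented_mul I rels).
Proof. by elim/presented_ind=> u; rewrite presented_mulE. Qed.

Lemma presented_mulr1 : right_id (presented_one rels) (@presented_mul I rels).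
Proof. by elim/presented_ind=> u; rewrite presented_mulE cats0. Qed.

Lemma presented_mulVg :
  left_inverse (presented_one rels) (@presented_inv I rels)
    (@presented_mul I rels).
Proof.
elim/presented_ind=> u; rewrite presented_invE presented_mulE.
by apply/class_of_wordP; exact: word_Vmul.
Qed.

Lemma presented_mulgV :
  right_inverse (presented_one rels) (@presented_inv I rels)
    (@presented_mul I rels).
Proof.
elim/presented_ind=> u; rewrite presented_invE presented_mulE.
by apply/class_of_wordP; exact: word_mulV.
Qed.

HB.instance Definition _ := isGroup.Build (presented rels)
  presented_mulA presented_mul1 presented_mulr1
  presented_mulVg presented_mulgV.

End PresentedGroup.

(* Indices are shifted by one: i : 'I_n.-1 stands for the generator s_(i+1).  *)
Inductive twin_rel (n : nat) : word 'I_n.-1 -> word 'I_n.-1 -> Prop :=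
  | TwinInvolution i : twin_rel [:: (i, true); (i, true)] [::]
  | TwinCommute (i j : 'I_n.-1) : (i + 2 <= j) || (j + 2 <= i) ->
      twin_rel [:: (i, true); (j, true)] [:: (j, true); (i, true)].

Definition twin (n : nat) : groupType := presented (@twin_rel n).

Definition twisted_conj (G : groupType) (phi : G -> G) (x y : G) : Prop :=
  exists g : G, x = g * y * (phi g)^-1.

Definition twisted_class (G : groupType) (phi : G -> G) (y : G) : set G :=
  [set x | twisted_conj phi x y].

Definition twisted_classes (G : groupType) (phi : G -> G) : set (set G) :=
  range (twisted_class phi).

Definition R_infinity (G : groupType) : Prop :=
  forall phi : {multiplicative G -> G}, bijective phi ->
    infinite_set (twisted_classes phi).

(* Main.v *)
(** Proof idea.  For a character chi : G -> {1, -1}, consider the integral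
    cocycles c, with c(gh) = c(g) + chi(g) c(h).  The space of cocycles of the
    twin group has rank 2 exactly when the generators on which chi is -1 form
    an interval {i, i+1} or {i, i+1, i+2}; it is then spanned over the integers
    by one cocycle c and by the coboundary (1 - chi)/2.  An automorphism phi
    permutes these interval characters.

    Let chi have orbit length m.  The norm N x = x phi(x) ... phi^(m-1)(x) turns
    phi-conjugacy into psi-conjugacy for psi = phi^m, which fixes chi, so that
    c o psi = l c + t (1 - chi)/2 with l = 1 or -1.  Among the x with
    chi(N x) = l, the number |2 c(N x) + l t| depends only on the twisted class
    of x.  It is unbounded as soon as such an x exists, because distinct
    characters have independent cocycles.  Such an x exists when the product of
    the orbit is a nontrivial character.

    If an odd number of interval characters are -1 on some generator s_k, then
    some orbit product is -1 on s_k; this holds for s_1 if n = 3, for s_2 if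
    n = 4 and for s_3 if n >= 6.  For n = 5 the interval {2, 3} is fixed by phi,
    being the only one whose cocycles modulo 2 meet nontrivially those of every
    other interval. *)
From HB Require Import structures.
Require Import Defs.
From mathcomp Require Import all_boot.
From mathcomp Require Import ssralg ssrnum ssrint zify.
From mathcomp Require Import boolp classical_sets cardinality.

Set Implicit Arguments.
Unset Strict Implicit.
Unset Printing Implicit Defensive.

Import GRing.Theory.
Local Open Scope ring_scope.

(** * Sign characters and integral cocycles, with [true] encoding the sign -1 *)

Definition signed (b : bool) (z : int) : int := if b then - z else z.

Definition character (G : groupType) (chi : G -> bool) :=
  forall x y, chi (x * y)%g = chi x (+) chi y.

Definition cocycle (G : groupType) (chi : G -> bool) (c : G -> int) :=
  forall x y, c (x * y)%g = c x + signed (chi x) (c y).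

Section Cocycles.
Context (G : groupType).
Implicit Types (chi : G -> bool) (c : G -> int) (x y g h : G).

Lemma character1 chi : character chi -> chi 1%g = false.
Proof. by move/(_ 1 1)%g; rewrite mulg1; case: (chi 1%g). Qed.

Lemma characterV chi x : character chi -> chi x^-1%g = chi x.
Proof.
move=> chiM; have := chiM x x^-1%g; rewrite mulgV character1 //.
by case: (chi x); case: (chi x^-1%g).
Qed.

Lemma cocycle1 chi c : character chi -> cocycle chi c -> c 1%g = 0.
Proof.
by move=> chiM /(_ 1 1)%g; rewrite mulg1 character1 //=; lia.
Qed.

Lemma cocycleV chi c x : character chi -> cocycle chi c ->
  c x^-1%g = - signed (chi x) (c x).
Proof.
move=> chiM cM; have := cM x x^-1%g.
by rewrite mulgV (cocycle1 chiM cM) /signed; case: (chi x); lia.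
Qed.

Lemma characterX chi x k : character chi -> chi x = false ->
  chi (x ^+ k)%g = false.
Proof.
move=> chiM chix; elim: k => [|k IHk]; first by rewrite expg0 character1.
by rewrite expgS chiM chix IHk.
Qed.

Lemma cocycleX chi c x k : character chi -> cocycle chi c -> chi x = false ->
  c (x ^+ k)%g = c x *+ k.
Proof.
move=> chiM cM chix; elim: k => [|k IHk].
  by rewrite expg0 (cocycle1 chiM cM).
by rewrite expgS cM chix IHk mulrS.
Qed.

Lemma cocycleJ chi c g x : character chi -> cocycle chi c -> chi x = false ->
  c (g * x * g^-1)%g = signed (chi g) (c x).
Proof.
move=> chiM cM chix; rewrite !cM chiM chix (cocycleV _ chiM cM) /signed.
by case: (chi g) => /=; lia.
Qed.

End Cocycles.

(** * Norms and an invariant of twisted conjugacy *)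

Section TwistedConjugacy.
Context (G : groupType) (phi : G -> G).
Hypothesis phiM : {morph phi : x y / (x * y)%g}.

Lemma multiplicative1 (f : G -> G) : {morph f : x y / (x * y)%g} -> f 1%g = 1%g.
Proof. by move=> fM; apply: (@mulgI _ (f 1%g)); rewrite -fM !mulg1. Qed.

Lemma multiplicativeV (f : G -> G) :
  {morph f : x y / (x * y)%g} -> {morph f : x / x^-1%g}.
Proof.
move=> fM x; apply: (@mulgI _ (f x)).
by rewrite -fM !mulgV multiplicative1.
Qed.

Lemma iter_morphM k : {morph iter k phi : x y / (x * y)%g}.
Proof. by elim: k => [|k IHk] x y //=; rewrite IHk phiM. Qed.

Lemma character_iter (chi : G -> bool) k :
  character chi -> character (chi \o iter k phi).
Proof. by move=> chiM x y; rewrite /= iter_morphM chiM. Qed.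

Lemma cocycle_iter (chi : G -> bool) (c : G -> int) k :
  cocycle chi c -> cocycle (chi \o iter k phi) (c \o iter k phi).
Proof. by move=> cM x y; rewrite /= iter_morphM cM. Qed.

Fixpoint twisted_power (x : G) (k : nat) : G :=
  if k is k'.+1 then (twisted_power x k' * iter k' phi x)%g else 1%g.

(** The product telescopes: each inner [(iter j phi g)^-1] meets [iter j phi g]. *)
Lemma twisted_power_conj k x y g : x = (g * y * (phi g)^-1)%g ->
  twisted_power x k = (g * twisted_power y k * (iter k phi g)^-1)%g.
Proof.
move=> xE; elim: k => [|k IHk] /=; first by rewrite mulg1 mulgV.
rewrite IHk xE !iter_morphM (multiplicativeV (iter_morphM k)) -iterSr /= !mulgA mulgVK //.
Qed.

(** The terms in [c g] cancel because [l * l = 1], and what remains is [2 * c u + l * t = signed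
    (chi g) (2 * c v + l * t)]. *)
Lemma twisted_conj_invariant (psi : G -> G) (chi : G -> bool) (c : G -> int)
    (l t : int) (u v g : G) :
  character chi -> cocycle chi c ->
  chi \o psi = chi -> (forall x, c (psi x) = l * c x + t * (chi x : nat)%:Z) ->
  l = signed (chi v) 1 -> u = (g * v * (psi g)^-1)%g ->
  absz (2 * c u + l * t) = absz (2 * c v + l * t).
Proof.
move=> chiM cM chipsi cpsi lE ->.
have chig : chi (psi g) = chi g by rewrite -[in RHS]chipsi.
rewrite !cM chiM (cocycleV _ chiM cM) chig cpsi /signed.
by move: lE; case: (chi g); case: (chi v) => /= ->; lia.
Qed.

Lemma infinite_twisted_classes (x : nat -> G) :
  (forall r s, twisted_conj phi (x r) (x s) -> r = s) ->
  infinite_set (twisted_classes phi).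
Proof.
move=> xinj.
apply: (@sub_infinite_set _ [set twisted_class phi (x r) | r in setT]%classic).
  by move=> _ [r _ <-]; exists (x r).
have /eq_finite_set -> :
    ([set twisted_class phi (x r) | r in setT] #= [set: nat])%card.
  apply: inj_card_eq => r s _ _ rs.
  apply: xinj; suff : twisted_class phi (x s) (x r) by [].
  by rewrite -rs; exists 1%g; rewrite mul1g (multiplicative1 phiM) invg1 mulg1.
exact: infinite_nat.
Qed.

Section Orbit.
Context (chi : G -> bool) (c : G -> int).
Hypothesis chiM : character chi.
Hypothesis cM : cocycle chi c.

(** If [chi \o iter l phi] and [chi] differ at [h], replace [y] by [y * (h * z * h^-1)] with [z]
    equal to [y] or [y^-1] according to the sign of [h]. This multiplies [c (iter k phi y)] by 1
    plus the product of the signs of [iter k phi h] and [h]: the factor is 2 for [k = 0] and 0 for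
    [k = l], and earlier zeros persist. *)
Lemma isolate_cocycle m y0 :
    (forall k, chi (iter k phi y0) = false) -> c y0 != 0 ->
    (forall k, 0 < k < m -> chi \o iter k phi <> chi)%N ->
  exists y, [/\ forall k, chi (iter k phi y) = false, c y != 0 &
    forall k, (0 < k < m)%N -> c (iter k phi y) = 0].
Proof.
move=> chiy0 cy0 chi_neq.
suff [y [chiy cy cky]] : exists y, [/\ forall k, chi (iter k phi y) = false,
    c y != 0 & forall k, (0 < k < m)%N -> (k < m)%N -> c (iter k phi y) = 0].
  by exists y; split=> // k k_m; apply: cky => //; case/andP: k_m.
(* Only the first copy of the bound varies: it counts the exponents already treated. *)
elim: {1}m => [|l [y [chiy cy cky]]].
  by exists y0; split=> // k; rewrite ltn0 andbF.
have [l_m|l_m] := boolP (0 < l < m)%N; last first.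
  exists y; split=> // k /andP[k0 kl] km; apply: cky => //.
  by rewrite k0 /= ltn_neqAle -ltnS kl andbT; apply: contra l_m => /eqP<-; rewrite k0.
have [h chih] : exists h, chi (iter l phi h) != chi h.
  apply/not_existsP => chih; apply: (chi_neq l l_m); apply/funext => h /=.
  by apply/eqP/negPn/negP/chih.
pose z := if chi h then y^-1%g else y.
have chiz k : chi (iter k phi z) = false.
  rewrite /z; case: (chi h) => //.
  by rewrite (multiplicativeV (iter_morphM k)) (characterV _ chiM).
have cz k : c (iter k phi z) = signed (chi h) (c (iter k phi y)).
  rewrite /z; case: (chi h) => //.
  by rewrite (multiplicativeV (iter_morphM k)) (cocycleV _ chiM cM) chiy.
have cyz k : c (iter k phi (y * (h * z * h^-1))%g) =
    c (iter k phi y) + signed (chi (iter k phi h)) (signed (chi h) (c (iter k phi y))).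
  rewrite !iter_morphM (multiplicativeV (iter_morphM k)) cM chiy /=.
  by rewrite (cocycleJ _ chiM cM) ?chiz // cz.
exists (y * (h * z * h^-1))%g; split.
- move=> k; rewrite !iter_morphM (multiplicativeV (iter_morphM k)) !chiM chiy chiz.
  by rewrite (characterV _ chiM) addbF addbb.
- by have := cyz 0%N; rewrite /= => ->; move: cy; rewrite /signed; case: (chi h); lia.
- move=> k /andP[k0 kl] km; rewrite cyz; have [->|kl'] := eqVneq k l.
    by move: chih; rewrite /signed; case: (chi h); case: (chi _) => //= _; lia.
  have -> : c (iter k phi y) = 0 by apply: cky => //; move/eqP: kl'; lia.
  by rewrite /signed; case: (chi h); case: (chi _).
Qed.

Lemma character_twisted_power x k :
  chi (twisted_power x k) = \big[addb/false]_(j < k) chi (iter j phi x).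
Proof.
elim: k => [|k IHk] /=; first by rewrite big_ord0 character1.
by rewrite big_ord_recr chiM IHk.
Qed.

(** All iterates of [z] have trivial sign, so signs of prefixes are unchanged, and [c] sees [z] only
    in the factor of index 0. *)
Lemma cocycle_twisted_power x z k :
    (forall j, chi (iter j phi z) = false) ->
    (forall j, (0 < j < k.+1)%N -> c (iter j phi z) = 0) ->
  c (twisted_power (x * z)%g k.+1) =
    c (twisted_power x k.+1) + signed (chi x) (c z).
Proof.
move=> chiz; elim: k => [_|k IHk cz]; first by rewrite /= !mul1g cM.
have {}IHk := IHk (fun j jk => cz j ltac:(lia)).
rewrite -[twisted_power _ k.+2]/(twisted_power _ k.+1 * _)%g cM IHk.
rewrite -[twisted_power x k.+2]/(twisted_power _ k.+1 * _)%g cM.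
rewrite !character_twisted_power.
under eq_bigr do rewrite iter_morphM chiM chiz addbF.
rewrite iter_morphM cM cz ?ltnSn // /signed.
by case: (chi x); case: (\big[_/_]_(_ < _) _); case: (chi _); lia.
Qed.

End Orbit.

End TwistedConjugacy.

(** Opposite values would give [a * (r + s) = - 2 * A], which the lower bounds on [r] and [s]
    exclude. *)
Lemma absz_affine_inj (A a : int) (r s : nat) : a != 0 ->
  (absz A < r)%N -> (absz A < s)%N -> absz (A + a * r%:Z) = absz (A + a * s%:Z) ->
  r = s.
Proof.
move=> a0 Ar As eq_abs.
have [eq_a|eq_a] : a * (r%:Z - s%:Z) = 0 \/ 2 * A + a * (r%:Z + s%:Z) = 0 by lia.
  by move/eqP: eq_a; rewrite mulf_eq0 (negPf a0) /=; lia.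
have : absz (a * (r%:Z + s%:Z)) = absz (2 * A) by lia.
rewrite abszM; have : (absz a > 0)%N by lia.
have -> : absz (r%:Z + s%:Z) = (r + s)%N by lia.
nia.
Qed.

(** * The criterion for infinitely many twisted classes *)

Theorem infinite_twisted_classes_of_cocycle (G : groupType) (phi : G -> G)
    (chi : G -> bool) (c : G -> int) (m : nat) :
    {morph phi : x y / (x * y)%g} -> bijective phi ->
    character chi -> cocycle chi c ->
    (forall c', cocycle chi c' ->
       exists l t : int, forall x, c' x = l * c x + t * (chi x : nat)%:Z) ->
    (exists g h, [/\ chi g, chi h & c g != c h]) ->
    chi \o iter m.+1 phi = chi ->
    (forall k, (0 < k < m.+1)%N -> chi \o iter k phi <> chi) ->
    (exists x, \big[addb/false]_(k < m.+1) chi (iter k phi x)) ->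
  infinite_set (twisted_classes phi).
Proof.
move=> phiM [phi' phiK phi'K] chiM cM c_basis [g0 [h0 [chig0 chih0 cgh]]].
move=> chim chi_neq [x1 chix1].
(* A square has trivial sign under every iterate, and [c y0 = 2 * (c g0 - c h0)]. *)
pose y0 := (g0 * h0 * (g0 * h0))%g.
have chiy0 k : chi (iter k phi y0) = false.
  by rewrite !(iter_morphM phiM) !chiM addbb.
have cy0 : c y0 != 0.
  by rewrite /y0 !cM !chiM chig0 chih0 /signed /=; lia.
have [y [chiy cy cky]] := isolate_cocycle phiM chiM cM chiy0 cy0 chi_neq.
have [l [t cphi]] : exists l t : int, forall x,
    c (iter m.+1 phi x) = l * c x + t * (chi x : nat)%:Z.
  by apply: (c_basis (c \o iter m.+1 phi)); rewrite -chim; exact: cocycle_iter.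
have phi'M : {morph phi' : x y / (x * y)%g}.
  by move=> u v; apply: (canLR phiK); rewrite phiM !phi'K.
have iterK u : iter m.+1 phi (iter m.+1 phi' u) = u.
  by elim: (m.+1) u => // k IHk u; rewrite iterSr iterS phi'K IHk.
have chim' : chi \o iter m.+1 phi' = chi.
  by rewrite -{1}chim; apply/funext => u /=; rewrite -!iterS iterK.
have [l' [t' cphi']] : exists l' t' : int, forall x,
    c (iter m.+1 phi' x) = l' * c x + t' * (chi x : nat)%:Z.
  by apply: (c_basis (c \o iter m.+1 phi')); rewrite -chim'; exact: cocycle_iter.
have chi0y : chi y = false := chiy 0%N.
(* At [y] the coboundary terms vanish, so the inverse automorphism inverts [l] in the integers. *)
have ll' : l * l' = 1.
  have := cphi (iter m.+1 phi' y).
  rewrite iterK cphi' -[chi (iter _ _ _)]/((chi \o iter m.+1 phi') y) chim' chi0y.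
  rewrite !mulr0 !addr0 mulrA => /esym/eqP.
  by rewrite -subr_eq0 -{2}[c y]mul1r -mulrBl mulf_eq0 (negPf cy) orbF subr_eq0 => /eqP.
have l_sign : l = 1 \/ l = -1.
  have /eqP : (absz l * absz l' = 1)%N by rewrite -abszM ll'.
  by rewrite muln_eq1 => /andP[/eqP]; lia.
have [x0 l_x0] : exists x0,
    l = signed (\big[addb/false]_(k < m.+1) chi (iter k phi x0)) 1.
  case: l_sign => ->; last by exists x1; rewrite chix1.
  exists 1%g; rewrite big1 // => k _.
  by rewrite (multiplicative1 (iter_morphM phiM k)) character1.
pose A := 2 * c (twisted_power phi x0 m.+1) + l * t.
(* The shift places every exponent beyond the bound of [absz_affine_inj]. *)
pose N r := (r + (absz A).+1)%N.
have chiyX k r : chi (iter k phi (y ^+ r)%g) = false.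
  exact: (@characterX _ (chi \o iter k phi)) (character_iter phiM k chiM) (chiy k).
have cyX k r : c (iter k phi (y ^+ r)%g) = c (iter k phi y) *+ r.
  by apply: (@cocycleX _ (chi \o iter k phi) (c \o iter k phi)) => //;
     [exact: character_iter | exact: cocycle_iter | exact: chiy].
have inv_x r : 2 * c (twisted_power phi (x0 * y ^+ N r)%g m.+1) + l * t =
    A + signed (chi x0) (2 * c y) * (N r)%:Z.
  rewrite (cocycle_twisted_power phiM chiM cM) //; last first.
    by move=> j j_m; rewrite cyX cky // mul0rn.
  have -> : c (y ^+ N r)%g = c y * (N r)%:Z.
    by have /= -> := cyX 0%N (N r); rewrite -mulr_natr natz.
  by rewrite /A /signed; case: (chi x0); lia.
apply: (infinite_twisted_classes phiM (x := fun r => (x0 * y ^+ N r)%g)).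
move=> r s [g /(twisted_power_conj phiM m.+1) rs].
suff : N r = N s by rewrite /N; lia.
apply: (@absz_affine_inj A (signed (chi x0) (2 * c y))); rewrite /N; try lia.
  by move: cy; rewrite /signed; case: (chi x0); lia.
rewrite -!inv_x; apply: (twisted_conj_invariant (psi := iter m.+1 phi)) rs => //.
rewrite l_x0 character_twisted_power //; congr (signed _ _).
apply: eq_bigr => k _.
by rewrite (iter_morphM phiM) chiM chiyX addbF.
Qed.

(** * Morphisms out of a presented group, and the infinite dihedral group *)

Section PresentedLift.
Context (I : choiceType) (rels : word I -> word I -> Prop) (H : groupType).
Context (f : I -> H).

Definition word_eval (u : word I) : H :=
  (\prod_(l <- u) (if l.2 then f l.1 else (f l.1)^-1))%g.

Hypothesis f_rels : forall u v, rels u v -> word_eval u = word_eval v.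

Lemma word_eval_eq u v : word_eq rels u v -> word_eval u = word_eval v.
Proof.
elim=> // {u v}.
- by move=> u v w _ -> _ ->.
- by move=> u u' v v' _ uu' _ vv'; rewrite /word_eval !big_cat; congr (_ * _)%g.
- move=> [i b]; rewrite /word_eval !big_cons big_nil /= mulg1.
  by case: b; rewrite /= ?mulgV ?mulVg.
Qed.

Lemma presented_lift : exists F : presented rels -> H,
  {morph F : x y / (x * y)%g} /\
  forall i, F (class_of_word rels [:: (i, true)]) = f i.
Proof.
exists (fun x => word_eval (repr x)); split=> [x y|i].
  rewrite -[RHS](@big_cat _ _ mul).
  apply: word_eval_eq; exact: word_eq_repr.
rewrite (word_eval_eq (word_eq_repr _ _)) /word_eval big_cons big_nil /=.
exact: mulg1.
Qed.

End PresentedLift.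

(* The pair (e, z) is the isometry t |-> (-1)^e t + z of the line, so that    *)
(* a morphism to this group is a character together with a cocycle.           *)
Definition int_dihedral : Type := (bool * int)%type.

HB.instance Definition _ := Choice.on int_dihedral.

Definition dihedral_mul (x y : int_dihedral) : int_dihedral :=
  (x.1 (+) y.1, x.2 + signed x.1 y.2).

Definition dihedral_inv (x : int_dihedral) : int_dihedral :=
  (x.1, - signed x.1 x.2).

Lemma dihedral_mulA : associative dihedral_mul.
Proof.
move=> [e x] [f y] [g z]; rewrite /dihedral_mul /signed /= addbA; congr pair.
by case: e; case: f => /=; lia.
Qed.

Lemma dihedral_mul1 : left_id (false, 0) dihedral_mul.
Proof. by move=> [e x]; rewrite /dihedral_mul /= add0r. Qed.

Lemma dihedral_mulr1 : right_id (false, 0) dihedral_mul.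
Proof.
by move=> [e x]; rewrite /dihedral_mul /signed /= addbF oppr0 if_same addr0.
Qed.

Lemma dihedral_mulVg : left_inverse (false, 0) dihedral_inv dihedral_mul.
Proof.
move=> [e x]; rewrite /dihedral_mul /dihedral_inv /signed /= addbb.
by congr pair; case: e; lia.
Qed.

Lemma dihedral_mulgV : right_inverse (false, 0) dihedral_inv dihedral_mul.
Proof.
move=> [e x]; rewrite /dihedral_mul /dihedral_inv /signed /= addbb.
by congr pair; case: e; lia.
Qed.

HB.instance Definition _ := isGroup.Build int_dihedral
  dihedral_mulA dihedral_mul1 dihedral_mulr1 dihedral_mulVg dihedral_mulgV.

(** * Characters and cocycles of the twin group on its generators *)

Section Twin.
Context (n : nat).
Local Notation N := n.-1.

Definition twin_gen (i : 'I_N) : twin n := class_of_word (@twin_rel n) [:: (i, true)].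

Lemma twin_gen_sq i : (twin_gen i * twin_gen i)%g = 1%g.
Proof.
rewrite [LHS]presented_mulE; apply/class_of_wordP/WordRel; exact: TwinInvolution.
Qed.

Lemma twin_gen_comm (i j : 'I_N) : (i + 2 <= j)%N ->
  (twin_gen i * twin_gen j)%g = (twin_gen j * twin_gen i)%g.
Proof.
move=> ij; rewrite [LHS]presented_mulE [RHS]presented_mulE.
by apply/class_of_wordP/WordRel/TwinCommute; rewrite ij.
Qed.

(** Generators are involutions, so inverse letters can be replaced by positive ones. *)
Lemma twin_ind (P : twin n -> Prop) :
  P 1%g -> (forall i x, P x -> P (twin_gen i * x)%g) -> forall x, P x.
Proof.
move=> P1 Pgen; elim/presented_ind; elim=> [//|[i b] u IHu].
suff -> : class_of_word (@twin_rel n) ((i, b) :: u) =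
    (twin_gen i * class_of_word (@twin_rel n) u)%g by exact: Pgen.
rewrite [RHS]presented_mulE; case: b => //.
suff genV : class_of_word (@twin_rel n) [:: (i, false)] = twin_gen i.
  by rewrite -cat1s -presented_mulE genV presented_mulE.
apply: (@mulgI _ (twin_gen i)); rewrite twin_gen_sq [LHS]presented_mulE.
exact/class_of_wordP/(WordCancel _ (i, true)).
Qed.

(** The hypotheses are the relations read in [int_dihedral]: a translation is an involution only if
    trivial, and two reflections commute only if equal. *)
Lemma twin_cocycle_exists (a : 'I_N -> bool) (v : 'I_N -> int) :
    (forall i, ~~ a i -> v i = 0) ->
    (forall i j : 'I_N, (i + 2 <= j)%N -> a i -> a j -> v i = v j) ->
  exists (chi : twin n -> bool) (c : twin n -> int), [/\ character chi,
    cocycle chi c, forall i, chi (twin_gen i) = a i &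
    forall i, c (twin_gen i) = v i].
Proof.
move=> v0 v_eq; pose f i : int_dihedral := (a i, v i).
have f_rels u w : twin_rel u w -> word_eval f u = word_eval f w.
  case=> [i|i j ij]; rewrite /word_eval !big_cons !big_nil /= ?mulg1.
    rewrite -[LHS]/(dihedral_mul (f i) (f i)) /dihedral_mul /= addbb /signed.
    congr pair.
    by have := v0 i; case: (a i) => [|->] //; lia.
  rewrite -[LHS]/(dihedral_mul (f i) (f j)) -[RHS]/(dihedral_mul (f j) (f i)).
  rewrite /dihedral_mul /= addbC /signed; congr pair.
  have {}v_eq : a i -> a j -> v i = v j.
    by case/orP: ij => ij ai aj; [exact: v_eq | apply/esym/v_eq].
  move: (v0 i) (v0 j) v_eq; case: (a i); case: (a j).
  - by move=> _ _ ->.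
  - by move=> _ ->//; lia.
  - by move=> -> // _; lia.
  - by move=> -> // ->.
have [F [FM Fgen]] := presented_lift f_rels.
exists (fun x => (F x).1), (fun x => (F x).2); split=> [x y|x y|i|i].
- by rewrite FM.
- by rewrite FM.
- by rewrite Fgen.
- by rewrite Fgen.
Qed.

Lemma twin_character_ext (chi psi : twin n -> bool) :
  character chi -> character psi ->
  (forall i, chi (twin_gen i) = psi (twin_gen i)) -> chi = psi.
Proof.
move=> chiM psiM chi_psi; apply/funext; elim/twin_ind.
  by rewrite !character1.
by move=> i x IHx; rewrite chiM psiM IHx chi_psi.
Qed.

Lemma cocycle_gen0 (chi : twin n -> bool) c i : character chi ->
  cocycle chi c -> ~~ chi (twin_gen i) -> c (twin_gen i) = 0.
Proof.
move=> chiM cM /negPf chi_i; have := cM (twin_gen i) (twin_gen i).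
by rewrite twin_gen_sq (cocycle1 chiM cM) chi_i /=; lia.
Qed.

Lemma cocycle_gen_comm (chi : twin n -> bool) c (i j : 'I_N) :
  cocycle chi c -> (i + 2 <= j)%N ->
  chi (twin_gen i) -> chi (twin_gen j) -> c (twin_gen i) = c (twin_gen j).
Proof.
move=> cM /twin_gen_comm ij chi_i chi_j.
have := cM (twin_gen i) (twin_gen j); rewrite ij cM chi_i chi_j /=; lia.
Qed.

End Twin.

(** * Nondegenerate characters and intervals *)

(** Such a [c] is no multiple of the coboundary (1 - chi)/2. The condition avoids generators, so
    automorphisms preserve it. *)
Definition nondegenerate (G : groupType) (chi : G -> bool) :=
  exists2 c, cocycle chi c & exists g h, [/\ chi g, chi h & c g != c h].

Lemma nondegenerate_comp (G : groupType) (phi phi' : G -> G) (chi : G -> bool) :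
  {morph phi : x y / (x * y)%g} -> cancel phi' phi ->
  nondegenerate chi -> nondegenerate (chi \o phi).
Proof.
move=> phiM phi'K [c cM [g [h [chig chih cgh]]]].
exists (c \o phi); first exact: (cocycle_iter phiM 1 cM).
by exists (phi' g), (phi' h); rewrite /= !phi'K.
Qed.

(** An index of [J] at distance at least 2 from both [p] and [p.+1] would force [C p = C p.+1]. Only
    [p.-1] and [p.+2] remain, and having both would equate [C p], [C p.+2], [C p.-1] and
    [C p.+1]. *)
Lemma support_interval (J : nat -> bool) (C : nat -> int) p :
    (forall j k, J j -> J k -> (j + 2 <= k)%N -> C j = C k) ->
    J p -> J p.+1 -> C p <> C p.+1 ->
  exists i (b : bool), forall k, J k = (i <= k <= i.+1 + b)%N.
Proof.
move=> J_eq Jp Jp1 Cp.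
have left k : J k -> (k.+1 < p)%N -> False.
  move=> Jk kp; have := J_eq _ _ Jk Jp; have := J_eq _ _ Jk Jp1; lia.
have right k : J k -> (p.+2 < k)%N -> False.
  move=> Jk kp; have := J_eq _ _ Jp Jk; have := J_eq _ _ Jp1 Jk; lia.
have both k : J k -> k.+1 = p -> J p.+2 -> False.
  move=> Jk kp Jp2; have := J_eq _ _ Jp Jp2; have := J_eq _ _ Jk Jp2.
  have := J_eq _ _ Jk Jp1; lia.
have [/andP[p0 Jp']|Jp'] := boolP ((0 < p)%N && J p.-1).
  exists p.-1, true => k.
  have [->|] := eqVneq k p; first by rewrite Jp; lia.
  have [->|] := eqVneq k p.+1; first by rewrite Jp1; lia.
  have [->|] := eqVneq k p.-1; first by rewrite Jp'; lia.
  have := left k; have := right k; have := both p.-1 Jp'.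
  have [->|] := eqVneq k p.+2; last by case: (J k) => *; lia.
  by case: (J p.+2) => *; lia.
exists p, (J p.+2) => k.
have [->|] := eqVneq k p; first by rewrite Jp; lia.
have [->|] := eqVneq k p.+1; first by rewrite Jp1; lia.
have [->|] := eqVneq k p.+2; first by case: (J p.+2); lia.
move: Jp'; have [->|] := eqVneq k p.-1.
  by case: (J p.-1); have := left k; have := right k; case: (J p.+2); lia.
by have := left k; have := right k; case: (J k); case: (J p.+2); lia.
Qed.

Section TwinCharacters.
Context (n : nat).
Local Notation N := n.-1.
Local Notation gen := (@twin_gen n).

Lemma cocycle_combination (chi : twin n -> bool) (c c' : twin n -> int) (l t : int) :
    character chi -> cocycle chi c -> cocycle chi c' ->
    (forall k, c' (gen k) = l * c (gen k) + t * (chi (gen k) : nat)%:Z) ->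
  forall x, c' x = l * c x + t * (chi x : nat)%:Z.
Proof.
move=> chiM cM c'M c'_gen; elim/twin_ind.
  by rewrite (cocycle1 chiM cM) (cocycle1 chiM c'M) character1 // !mulr0.
move=> i x IHx; rewrite cM c'M chiM c'_gen IHx /signed.
by case: (chi (gen i)); case: (chi x) => /=; lia.
Qed.

Lemma nondegenerate_support (chi : twin n -> bool) :
    character chi -> nondegenerate chi ->
  exists i (b : bool), (i.+1 + b < N)%N /\
    forall k : 'I_N, chi (gen k) = (i <= k <= i.+1 + b)%N.
Proof.
move=> chiM [c cM [g [h [chig chih cgh]]]].
(* The default values put indices out of range outside the support. *)
pose J (k : nat) := if insub k is Some o then chi (gen o) else false.
pose C (k : nat) := if insub k is Some o then c (gen o) else 0.
have JE (o : 'I_N) : J o = chi (gen o) by rewrite /J valK.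
have CE (o : 'I_N) : C o = c (gen o) by rewrite /C valK.
have J_ord k : J k -> exists o : 'I_N, k = o.
  by rewrite /J; case: insubP => // o _ <- _; exists o.
have J_eq j k : J j -> J k -> (j + 2 <= k)%N -> C j = C k.
  move=> Jj Jk; have [oj ej] := J_ord _ Jj; have [ok ek] := J_ord _ Jk.
  move: Jj Jk; rewrite {}ej {}ek !JE !CE => Jj Jk jk.
  exact: cocycle_gen_comm cM jk Jj Jk.
(* Otherwise [c] is constant on the generators of sign -1, hence a multiple of the coboundary,
   against [cgh]. *)
have [p [Jp Jp1 Cp]] : exists p, [/\ J p, J p.+1 & C p <> C p.+1].
  apply: contrapT => no_p.
  have J_const j k : J j -> J k -> C j = C k.
    wlog jk : j k / (j <= k)%N.
      by move=> W Jj Jk; case/orP: (leq_total j k) => ?; [|symmetry]; apply: W.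
    move=> Jj Jk; have [->//|neq_jk] := eqVneq j k.
    have [k_j|k_j] := eqVneq k j.+1; last by apply: J_eq => //; lia.
    move: Jk; rewrite k_j => Jj1; apply: contrapT => Cj.
    by apply: no_p; exists j.
  have [t ct] : exists t : int, forall k : 'I_N, chi (gen k) -> c (gen k) = t.
    have [[k Jk]|no_k] := pselect (exists k : 'I_N, chi (gen k)).
      by exists (c (gen k)) => j Jj; rewrite -!CE; apply: J_const; rewrite JE.
    by exists 0 => k Jk; case: no_k; exists k.
  have cE : forall x, c x = 0 * c x + t * (chi x : nat)%:Z.
    apply: cocycle_combination => // k; have [Jk|Jk] := boolP (chi (gen k)).
      by rewrite ct //; lia.
    by rewrite (cocycle_gen0 chiM cM Jk); lia.
  by move: cgh; rewrite (cE g) (cE h) !mul0r chig chih eqxx.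
have [i [b JE']] := support_interval J_eq Jp Jp1 Cp.
exists i, b; split; last by move=> k; rewrite -JE JE'.
by have [|o ->] := J_ord (i.+1 + b)%N; [rewrite JE'; lia | exact: ltn_ord].
Qed.

(* On an interval {i, i+1} or {i, i+1, i+2} the commuting generators form the *)
(* two components {i+1} and its complement.                                   *)
Lemma interval_cocycle (chi : twin n -> bool) (i : nat) (b : bool) (v : nat -> int) :
    character chi -> (i.+1 + b < N)%N ->
    (forall k : 'I_N, chi (gen k) = (i <= k <= i.+1 + b)%N) ->
    (forall k, ~~ (i <= k <= i.+1 + b)%N -> v k = 0) -> (b -> v i = v i.+2) ->
  exists2 c, cocycle chi c & forall k, c (gen k) = v k.
Proof.
move=> chiM iN chiE v0 vb.
have [] := @twin_cocycle_exists n (fun k => chi (gen k)) (fun k => v k).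
- by move=> k; rewrite chiE => /v0.
- move=> j k jk; rewrite !chiE => Jj Jk.
  have -> : j = i :> nat by case: (b) Jk Jj; lia.
  have -> : k = i.+2 :> nat by case: (b) Jk Jj; lia.
  by apply: vb; case: (b) Jk Jj; lia.
move=> psi [c [psiM cM psi_gen c_gen]]; exists c => //.
by rewrite (twin_character_ext chiM psiM) // => k; rewrite psi_gen.
Qed.

(** On generators [c] is the indicator of [i.+1], while the coboundary is that of the whole
    interval; the values of [c'] at [i] and [i.+1] determine the coefficients. *)
Lemma interval_basis (chi : twin n -> bool) (i : nat) (b : bool) :
    character chi -> (i.+1 + b < N)%N ->
    (forall k : 'I_N, chi (gen k) = (i <= k <= i.+1 + b)%N) ->
  exists c, [/\ cocycle chi c, exists g h, [/\ chi g, chi h & c g != c h] &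
    forall c', cocycle chi c' ->
      exists l t : int, forall x, c' x = l * c x + t * (chi x : nat)%:Z].
Proof.
move=> chiM iN chiE.
have [|_|c cM c_gen] := @interval_cocycle chi i b (fun k => (k == i.+1)%:Z) chiM iN chiE.
- by move=> k; lia.
- by congr Posz; lia.
have iN' : (i < N)%N by lia.
have i1N : (i.+1 < N)%N by lia.
pose o := Ordinal iN'; pose o1 := Ordinal i1N.
exists c; split=> //.
  exists (gen o1), (gen o); rewrite !chiE !c_gen /=; split; lia.
move=> c' c'M; exists (c' (gen o1) - c' (gen o)), (c' (gen o)).
apply: cocycle_combination => // k.
have [Jk|Jk] := boolP (chi (gen k)); last first.
  by rewrite !(cocycle_gen0 chiM _ Jk) //; lia.
rewrite c_gen; have [ko1|] := eqVneq (k : nat) i.+1.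
  by rewrite (_ : k = o1); [lia | exact: val_inj].
have [ko|] := eqVneq (k : nat) i.
  by rewrite (_ : k = o); [lia | exact: val_inj].
move=> k_i k_i1; suff -> : c' (gen k) = c' (gen o) by lia.
apply/esym/(cocycle_gen_comm c'M _ _ Jk); rewrite ?chiE /=; try lia.
by move: Jk; rewrite chiE; lia.
Qed.

End TwinCharacters.

(** * Parity of orbits and parity of integers *)

(** The total parity is the sum of the parities over the orbits, indexed by their roots, so some
    orbit is odd. *)
Lemma odd_orbit (T : finType) (f : T -> T) (S P : pred T) :
    injective f -> (forall a, S a -> S (f a)) -> odd #|[pred a | S a && P a]| ->
  exists2 a, S a & \big[addb/false]_(k < order f a) P (iter k f a).
Proof.
move=> f_inj Sf odd_SP.
have : \big[addb/false]_(a | S a) P a.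
  have -> : \big[addb/false]_(a | S a) P a = odd #|[pred a | S a && P a]|.
    rewrite -sum1_card (big_morph odd oddD (erefl (odd 0))) /=.
    by rewrite [RHS]big_mkcondr; apply: eq_bigr => a _; case: (P a).
  exact: odd_SP.
apply: contraTP => no_a.
rewrite (partition_big (froot f) xpredT) //= big1 // => r _.
have [a /andP[Sa /eqP ar]|no_r] := pickP [pred a | S a && (froot f a == r)]; last first.
  by rewrite big_pred0.
have -> : \big[addb/false]_(a0 | S a0 && (froot f a0 == r)) P a0 =
   \big[addb/false]_(a0 in orbit f a) P a0.
  apply: eq_bigl => x; rewrite -ar eq_sym.
  rewrite root_connect; last exact: fconnect_sym.
  rewrite fconnect_orbit andbC; case: (boolP (x \in orbit f a)) => //= /trajectP[k _ ->].
  by elim: k => //= k; exact: Sf.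
rewrite -big_uniq ?orbit_uniq // (big_nth a) size_orbit big_mkord.
under eq_bigr => k _ do rewrite nth_traject //.
by apply/negP => odd_a; apply: no_a; exists a.
Qed.

Lemma odd_abszD (x y : int) : odd (absz (x + y)) = odd (absz x) (+) odd (absz y).
Proof.
apply: (@Num.Theory.signr_inj int).
by rewrite signr_addb !signr_odd -!expN1r exprzDr ?unitrN1.
Qed.

(** * The action of an automorphism on interval characters *)

Section TwinAutomorphism.
Context (n : nat).
Local Notation N := n.-1.
Local Notation gen := (@twin_gen n).
Local Notation T := {ffun 'I_N -> bool}.

(** Coding characters by their values on generators gives a finite type, to which [odd_orbit]
    applies. *)
Lemma twin_characters : exists X : T -> twin n -> bool,
  (forall a, character (X a)) /\ (forall a k, X a (gen k) = a k).
Proof.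
have /choice[X XP] (a : T) : exists chi : twin n -> bool,
    character chi /\ forall k, chi (gen k) = a k.
  have [//|//|chi [c [chiM _ chi_gen _]]] := @twin_cocycle_exists n a (fun=> 0).
  by exists chi.
by exists X; split=> [a|a k]; have [] := XP a.
Qed.

Context (X : T -> twin n -> bool).
Hypothesis XM : forall a, character (X a).
Hypothesis X_gen : forall a k, X a (gen k) = a k.

Definition interval (i : nat) (b : bool) : T :=
  [ffun k : 'I_N => (i <= k <= i.+1 + b)%N].

Lemma X_inj : injective X.
Proof. by move=> a a' aa'; apply/ffunP => k; rewrite -!X_gen aa'. Qed.

Lemma nondegenerate_interval a : nondegenerate (X a) <->
  exists i (b : bool), (i.+1 + b < N)%N /\ a = interval i b.
Proof.
split=> [/(nondegenerate_support (XM a))[i [b [iN aE]]]|[i [b [iN ->]]]].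
  by exists i, b; split=> //; apply/ffunP => k; rewrite ffunE -X_gen.
have [|c [cM cgh _]] := interval_basis (XM (interval i b)) iN.
  by move=> k; rewrite X_gen ffunE.
by exists c.
Qed.

Context (phi phi' : twin n -> twin n).
Hypothesis phiM : {morph phi : x y / (x * y)%g}.
Hypothesis phiK : cancel phi phi'.
Hypothesis phi'K : cancel phi' phi.

Definition pullback (a : T) : T := [ffun k => X a (phi (gen k))].

Lemma X_pullback a : X (pullback a) = X a \o phi.
Proof.
apply: twin_character_ext; [exact: XM | exact: (character_iter phiM 1 (XM a)) |].
by move=> k; rewrite X_gen ffunE.
Qed.

Lemma X_iter_pullback k a : X (iter k pullback a) = X a \o iter k phi.
Proof.
elim: k => [|k IHk]; first by apply/funext.
by rewrite iterS X_pullback IHk; apply/funext => x /=; rewrite -iterSr.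
Qed.

Lemma pullback_inj : injective pullback.
Proof.
move=> a a' aa'; apply: X_inj; apply/funext => x.
have : X a \o phi = X a' \o phi by rewrite -!X_pullback aa'.
by move/(congr1 (fun g => g (phi' x))); rewrite /= phi'K.
Qed.

Lemma nondegenerate_pullback a :
  nondegenerate (X a) -> nondegenerate (X (pullback a)).
Proof. rewrite X_pullback; exact: nondegenerate_comp phi'K. Qed.

Lemma infinite_twisted_classes_twin (S : pred T) (k0 : 'I_N) :
    (forall a, S a -> nondegenerate (X a)) ->
    (forall a, S a -> S (pullback a)) ->
    odd #|[pred a : T | S a && a k0]| ->
  infinite_set (twisted_classes phi).
Proof.
move=> S_nd S_pull odd_S.
have [a Sa odd_a] := @odd_orbit _ _ S (fun a => a k0) pullback_inj S_pull odd_S.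
have [i [b [iN aE]]] := (nondegenerate_interval a).1 (S_nd a Sa).
have [|c [cM cgh c_basis]] := interval_basis (XM a) iN.
  by move=> k; rewrite X_gen aE ffunE.
have order_a : (order pullback a).-1.+1 = order pullback a := orderSpred pullback a.
apply: (@infinite_twisted_classes_of_cocycle _ phi (X a) c (order pullback a).-1)
  => //.
- by exists phi'.
- by rewrite order_a -X_iter_pullback iter_order //; exact: pullback_inj.
- move=> k; rewrite order_a => /andP[k0_gt k_lt]; rewrite -X_iter_pullback.
  move=> /X_inj ak; have := findex_iter k_lt; rewrite ak findex0 => k_0.
  by rewrite -k_0 in k0_gt.
- exists (gen k0); rewrite order_a; move: odd_a; congr is_true.
  apply: eq_bigr => k _.
  by rewrite -X_gen X_iter_pullback.
Qed.

Lemma interval_inj (i i' : nat) (b b' : bool) :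
  (i.+1 + b < N)%N -> (i'.+1 + b' < N)%N -> interval i b = interval i' b' ->
  (i, b) = (i', b').
Proof.
move=> iN iN' /ffunP ii'.
have E k : (k < N)%N -> (i <= k <= i.+1 + b)%N = (i' <= k <= i'.+1 + b')%N.
  by move=> kN; have := ii' (Ordinal kN); rewrite !ffunE.
have := E i ltac:(lia); have := E i' ltac:(lia).
have := E _ iN; have := E _ iN'.
by move=> *; congr pair; lia.
Qed.

(** Here the stable set consists of all interval characters, and [L] lists the intervals containing
    [k0]. *)
Lemma infinite_twisted_classes_count (k0 : 'I_N) (L : seq (nat * bool)) :
    uniq L -> odd (size L) ->
    (forall i (b : bool), ((i, b) \in L) =
      (i.+1 + b < N)%N && (i <= k0 <= i.+1 + b)%N) ->
  infinite_set (twisted_classes phi).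
Proof.
move=> L_uniq L_odd LP.
apply: (@infinite_twisted_classes_twin (fun a => `[< nondegenerate (X a) >]) k0).
- by move=> a /asboolP.
- by move=> a /asboolP/nondegenerate_pullback/asboolP.
pose LT := [seq interval p.1 p.2 | p <- L].
have LT_uniq : uniq LT.
  rewrite map_inj_in_uniq // => -[i b] [i' b'] /=.
  by rewrite !LP => /andP[iN _] /andP[iN' _]; exact: interval_inj.
suff -> : #|[pred a : T | `[< nondegenerate (X a) >] && a k0]| = size LT.
  by rewrite size_map.
rewrite -(card_uniqP LT_uniq); apply: eq_card => a; rewrite !inE.
apply/andP/mapP => [[/asboolP/nondegenerate_interval[i [b [iN ->]]]]|[[i b] ib ->]].
  by rewrite ffunE => ik; exists (i, b); rewrite // LP iN.
move: ib; rewrite LP => /andP[iN ik]; split; last by rewrite ffunE.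
by apply/asboolP/nondegenerate_interval; exists i, b.
Qed.

(* The generator values of a cocycle of {i, i+1} or {i, i+1, i+2} modulo 2 are  *)
(* spanned by {i+1} and its complement; for n = 5, the interval {2, 3} is the   *)
(* only one for which these spans meet the span of every other interval.        *)
Definition central (chi : twin n -> bool) :=
  forall a, nondegenerate (X a) -> exists c c', [/\ cocycle chi c,
    cocycle (X a) c', forall x, odd (absz (c x)) = odd (absz (c' x)) &
    exists x, odd (absz (c x))].

(** To test against [a'], apply centrality of [X a] to [X a' \o phi'] and compose the two cocycles
    with [phi]. *)
Lemma central_pullback a : central (X a) -> central (X (pullback a)).
Proof.
rewrite X_pullback => a_central a' nd_a'.
have phi'M : {morph phi' : x y / (x * y)%g}.
  by move=> u v; apply: (canLR phiK); rewrite phiM !phi'K.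
pose a'' : T := [ffun k => X a' (phi' (gen k))].
have a''E : X a'' = X a' \o phi'.
  apply: twin_character_ext; [exact: XM | exact: (character_iter phi'M 1 (XM a')) |].
  by move=> k; rewrite X_gen ffunE.
have [|c [c' [cM c'M cc' [x odd_cx]]]] := a_central a''.
  by rewrite a''E; exact: nondegenerate_comp phiK nd_a'.
exists (c \o phi), (c' \o phi); split.
- exact: (cocycle_iter phiM 1 cM).
- have -> : X a' = X a'' \o phi by rewrite a''E; apply/funext => y /=; rewrite phiK.
  exact: (cocycle_iter phiM 1 c'M).
- by move=> y; exact: cc'.
- by exists (phi' x); rewrite /= phi'K.
Qed.

(** Modulo 2 the signs disappear, so a cocycle becomes a homomorphism. *)
Lemma cocycle_odd_ext (chi psi : twin n -> bool) c c' : character chi ->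
    character psi -> cocycle chi c -> cocycle psi c' ->
    (forall k, odd (absz (c (gen k))) = odd (absz (c' (gen k)))) ->
  forall x, odd (absz (c x)) = odd (absz (c' x)).
Proof.
move=> chiM psiM cM c'M c_gen; elim/twin_ind.
  by rewrite (cocycle1 chiM cM) (cocycle1 psiM c'M).
have odd_signed b z : odd (absz (signed b z)) = odd (absz z).
  by case: b => //=; rewrite abszN.
by move=> k x IHx; rewrite cM c'M !odd_abszD !odd_signed c_gen IHx.
Qed.

Lemma central_middle : N = 4%N -> central (X (interval 1 false)).
Proof.
move=> N4 a /nondegenerate_interval[i [b [iN aE]]].
(* Counting from 0, the middle interval is {1, 2}, with components {1} and {2}. Each interval has
   one of these as a component: {1} for {0, 1}, {0, 1, 2} and {1, 2}, and {2} for {2, 3} and {1, 2,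
   3}. *)
pose v (k : nat) : int :=
  (k == if (i == 0)%N || ((i == 1)%N && ~~ b) then 1%N else 2%N)%:Z.
have [|||||c cM c_gen] := @interval_cocycle n (X (interval 1 false)) 1 false v.
- exact: XM.
- by rewrite N4.
- by move=> k; rewrite X_gen ffunE.
- by move=> k; rewrite /v; case: ifP => _; lia.
- by [].
have [|||c' c'M c'_gen] := @interval_cocycle n (X a) i b v (XM a) iN.
- by move=> k; rewrite X_gen aE ffunE.
- by move=> k; rewrite /v; move: iN; rewrite N4; case: (b); case: ifP; lia.
- by rewrite /v => b1; move: iN; rewrite N4 b1 /= andbF orbF; case: ifP; lia.
have odd_cc' : forall x, odd (absz (c x)) = odd (absz (c' x)).
  by apply: cocycle_odd_ext cM c'M _ => // k; rewrite c_gen c'_gen.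
exists c, c'; split=> //.
have mN : ((if (i == 0)%N || ((i == 1)%N && ~~ b) then 1 else 2) < N)%N.
  by rewrite N4; case: ifP.
by exists (gen (Ordinal mN)); rewrite c_gen /v /= eqxx.
Qed.

Lemma central_middle_unique a : N = 4%N -> nondegenerate (X a) -> central (X a) ->
  a = interval 1 false.
Proof.
move=> N4 /nondegenerate_interval[i [b [iN aE]]] a_central.
apply: contrapT => a_neq.
(* The test interval, {2, 3} or {0, 1}, is disjoint from the support of [a] or meets it in one
   end. *)
pose j := if (i == 0)%N then 2%N else 0%N.
have [|c [c' [cM c'M cc' [x]]]] := a_central (interval j false).
  apply/nondegenerate_interval; exists j, false; split=> //.
  by rewrite /j N4; case: ifP.
have ib : ~ (i = 1%N /\ b = false) by move=> [i1 b0]; apply: a_neq; rewrite aE i1 b0.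
have c_gen0 (k : 'I_N) : ~~ (i <= k <= i.+1 + b)%N -> c (gen k) = 0.
  by move=> ik; apply: (cocycle_gen0 (XM a) cM); rewrite X_gen aE ffunE.
have c_gen_even (k : 'I_N) : ~~ (j <= k <= j.+1)%N -> odd (absz (c (gen k))) = false.
  move=> jk; rewrite cc' (cocycle_gen0 (XM _) c'M) // X_gen ffunE; move: jk; lia.
have c_even (k : 'I_N) : odd (absz (c (gen k))) = false.
  have [jk|/c_gen_even//] := boolP (j <= k <= j.+1)%N.
  have [ik|/c_gen0->//] := boolP (i <= k <= i.+1 + b)%N.
  (* An overlap [k] is one end of a support of three elements and [k'] is the other end. These
     generators commute, so [c] agrees on them, and [k'] lies off the test interval. *)
  pose k' := if (i == 0)%N then 0%N else 3%N.
  have k'N : (k' < N)%N by rewrite /k' N4; case: ifP.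
  pose o := Ordinal k'N.
  have <- : c (gen o) = c (gen k).
    have chiE (l : 'I_N) : X a (gen l) = (i <= l <= i.+1 + b)%N by rewrite X_gen aE ffunE.
    have iN4 : (i.+1 + b < 4)%N by rewrite -N4.
    by case: (ltnP o k) => ok; [|apply/esym];
      apply: (cocycle_gen_comm cM); rewrite ?chiE; move: ok jk;
      rewrite /= /j /k'; case: ifP => i0; case: (b) iN4 ik ib => /=; lia.
  by apply: c_gen_even; rewrite /= /j /k'; case: ifP.
have := cocycle_odd_ext (XM a) (XM a) cM (c' := fun=> 0) _ _ x.
by rewrite /= => -> // u w; rewrite /signed; case: (X a u).
Qed.

Lemma infinite_twisted_classes_T5 : N = 4%N -> infinite_set (twisted_classes phi).
Proof.
move=> N4; have N1 : (1 < N)%N by rewrite N4.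
have nd : nondegenerate (X (interval 1 false)).
  by apply/nondegenerate_interval; exists 1%N, false; split=> //; rewrite N4.
have fixed : pullback (interval 1 false) = interval 1 false.
  apply: central_middle_unique => //; first exact: nondegenerate_pullback.
  exact/central_pullback/central_middle.
apply: (@infinite_twisted_classes_twin (pred1 (interval 1 false)) (Ordinal N1)).
- by move=> a /eqP ->.
- by move=> a /eqP ->; rewrite /= fixed.
suff -> : #|[pred a : T | pred1 (interval 1 false) a && a (Ordinal N1)]| = 1%N by [].
rewrite -[RHS](card1 (interval 1 false)); apply: eq_card => a; rewrite !inE /=.
by case: eqP => //= ->; rewrite ffunE.
Qed.

End TwinAutomorphism.

(** * The theorem, by cases on n *)

Local Open Scope nat_scope.

Theorem theorem4p4 (n : nat) (hn : 3 <= n) : R_infinity (twin n).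
Proof.
move=> phi [phi' phiK phi'K].
have phiM : {morph phi : x y / (x * y)%g} := @gmulfM _ _ phi.
have [X [XM X_gen]] := twin_characters n.
have count := infinite_twisted_classes_count XM X_gen phiM phiK phi'K.
have [n3|n3] := eqVneq n 3%N.
  have kN : (0 < n.-1)%N by rewrite n3.
  apply: (count (Ordinal kN) [:: (0%N, false)]) => // i b.
  by rewrite !inE xpair_eqE /= n3; case: b; lia.
have [n4|n4] := eqVneq n 4%N.
  have kN : (1 < n.-1)%N by rewrite n4.
  apply: (count (Ordinal kN) [:: (0%N, false); (1%N, false); (0%N, true)]) => // i b.
  by rewrite !inE !xpair_eqE /= n4; case: b; lia.
(* For n = 5 every generator lies in an even number of intervals, so counting does not suffice. *)
have [n5|n5] := eqVneq n 5%N.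
  by apply: (infinite_twisted_classes_T5 XM X_gen phiM phiK phi'K); rewrite n5.
(* The longest interval starting at 2 ends at 4, which is in range because n is at least 6. *)
have kN : (2 < n.-1)%N by lia.
apply: (count (Ordinal kN)
  [:: (1%N, false); (2%N, false); (0%N, true); (1%N, true); (2%N, true)]) => // i b.
by rewrite !inE !xpair_eqE /=; case: b; lia.
Qed.
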